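(* Let $(V,\mathcal B)$ be a symmetric $2$-$(v,k,\lambda)$ design and let $\mathbf b=\{b_1,\dots,b_k\}\in\mathcal B$ be a block. Suppose $\mathbf b_1,\dots,\mathbf b_k$ are pairwise distinct blocks of $\mathcal B$, none equal to $\mathbf b$, such that (1) $b_i\notin\mathbf b_i$ for all $1\le i\le k$, and (2) for all $j\ne l$ in $\{1,\dots,k\}$, $b_j\in\mathbf b_l$ implies $b_l\notin\mathbf b_j$. Let $\mathcal B'$ be obtained from $\mathcal B$ by adjoining the point $b_i$ to the block $\mathbf b_i$ for every $1\le i\le k$ and then removing the block $\mathbf b$. Then the dual $(V,\mathcal B')^\perp$ is a $2$-$(v-1,k,\lambda)$ adesign.
   Context: A symmetric $2$-$(v,k,\lambda)$ design has $v$ points and $v$ blocks of size $k$, every pair of points lying in exactly $\lambda$ blocks. The dual of an incidence structure $(V,\mathcal C)$ has the blocks of $\mathcal C$ as points, and for each $p\in V$ the block consisting of the members of $\mathcal C$ containing $p$. A $t$-$(v,k,\lambda)$ adesign is an incidence structure with $v$ points and blocks of size $k$ such that every $t$-subset of points lies in exactly $\lambda$ or exactly $\lambda+1$ blocks, both values occurring.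
   Formalization: The parameters k and λ are assumed positive; for λ = 0 the claim fails, e.g. for the 2-(3,1,0) design of singletons, where no pair of points of the dual lies in λ+1 = 1 block, and for k = 0 it fails likewise. *)

(* Defs.v *)
From mathcomp Require Import all_boot.

Set Implicit Arguments.
Unset Strict Implicit.
Unset Printing Implicit Defensive.

(* An incidence structure is a family of blocks [B : J -> {set P}] on a finite
   point type [P].  Blocks are counted by index, so repeated blocks are allowed;
   this makes the dual an involution up to extensionality, with exactly one
   block per point of the original structure. *)

(* Number of blocks containing all points of [A]. *)
Definition nblocks (P J : finType) (B : J -> {set P}) (A : {set P}) : nat :=
  #|[set j | A \subset B j]|.

Definition is_design (P J : finType) (B : J -> {set P}) (t v k lambda : nat) :=
  [/\ #|P| = v,
      forall j : J, #|B j| = k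
    & forall A : {set P}, #|A| = t -> nblocks B A = lambda].

Definition is_symmetric_2design (P J : finType) (B : J -> {set P})
    (v k lambda : nat) :=
  is_design B 2 v k lambda /\ #|J| = v.

Definition is_adesign (P J : finType) (B : J -> {set P}) (t v k lambda : nat) :=
  [/\ #|P| = v,
      forall j : J, #|B j| = k,
      forall A : {set P}, #|A| = t ->
        nblocks B A = lambda \/ nblocks B A = lambda.+1,
      exists A : {set P}, #|A| = t /\ nblocks B A = lambda
    & exists A : {set P}, #|A| = t /\ nblocks B A = lambda.+1].

Definition dual (P J : finType) (B : J -> {set P}) : P -> {set J} :=
  fun p => [set j | p \in B j].

(* Adjoin the point [pt i] to the block of index [blk i], for every [i < k],
   then remove the block of index [j0]. *)
Definition adjoin_remove (P J : finType) (B : J -> {set P}) (j0 : J) (k : nat)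
    (pt : 'I_k -> P) (blk : 'I_k -> J) : {j : J | j != j0} -> {set P} :=
  fun j => B (val j) :|: [set pt i | i : 'I_k & blk i == val j].
Arguments adjoin_remove {P J} B j0 {k} pt blk _.

(* Main.v *)
(** Counting flags in two ways gives [r = k] blocks through each point, and
    counting triples gives [\sum_j (#|B j :&: B j0| - lambda)^2 = 0] over
    [j != j0], so two blocks meet in [lambda] points.  Adjoining the points then
    adds at most one point to the intersection of two blocks: conflicts between
    the two possible new points are excluded by [pt_asym].  The value [lambda.+1]
    occurs for [blk a] and another block through [pt a].  The value [lambda]
    occurs for a block outside the range of [blk] (if there is none, then
    [v = k.+1] and [lambda = k.-1], so that each [B (blk a)] contains every
    [pt b] with [b != a], contradicting [pt_asym]). *)
Require Import Defs.
From mathcomp Require Import all_boot.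
From mathcomp Require Import zify.

Set Implicit Arguments.
Unset Strict Implicit.
Unset Printing Implicit Defensive.

Section Incidence.
Variables (P J : finType) (B : J -> {set P}).

(** Both sides count the flags [(p, j)] with [p] in [A] and [j] in [D]. *)
Lemma sum_card_setI (A : {set P}) (D : {set J}) :
  \sum_(j in D) #|A :&: B j| = \sum_(p in A) #|D :&: dual B p|.
Proof.
under eq_bigr do rewrite -sum1_card.
under [RHS]eq_bigr do rewrite -sum1_card.
rewrite (exchange_big_dep (mem A)) /=; last by move=> j p _; case/setIP.
apply: eq_bigr => p pA; apply: eq_bigl => j.
by rewrite !inE pA.
Qed.

Lemma nblocks2 (p q : P) : nblocks B [set p; q] = #|dual B p :&: dual B q|.
Proof.
by apply: eq_card => j; rewrite !inE subUset !sub1set.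
Qed.

Lemma nblocks_dual2 (j l : J) : nblocks (dual B) [set j; l] = #|B j :&: B l|.
Proof.
by apply: eq_card => p; rewrite !inE subUset !sub1set !inE.
Qed.

End Incidence.

Section SymmetricDesign.
Variables (V J : finType) (B : J -> {set V}) (v k lambda : nat).
Hypothesis symB : is_symmetric_2design B v k lambda.

Lemma sum_dualI (A : {set V}) (p : V) : p \in A ->
  \sum_(q in A) #|dual B p :&: dual B q| = #|dual B p| + #|A|.-1 * lambda.
Proof.
case: symB => -[_ _ B2] _ pA; rewrite (bigD1 p) //= setIid; congr (_ + _).
rewrite (eq_bigr (fun=> lambda)) => [|q /andP[_ qp]].
  rewrite sum_nat_const; congr (_ * _); rewrite (cardsD1 p A) pA /=.
  by apply: eq_card => q; rewrite !inE andbC.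
by rewrite -nblocks2 B2 // cards2 eq_sym qp.
Qed.

(** Double count of the flags [(q, j)] with [j] a block through [p]. At this stage the number of
    such blocks may still depend on [p]. *)
Lemma card_dual_mul (p : V) : #|dual B p| * k = #|dual B p| + v.-1 * lambda.
Proof.
case: (symB) => -[cV Bk _] _.
rewrite -[in v.-1]cV -cardsT -sum_dualI ?inE // -sum_card_setI.
by under eq_bigr do rewrite setTI Bk; rewrite sum_nat_const.
Qed.

Hypotheses (lambda_gt0 : 0 < lambda) (v_gt1 : 1 < v).

(** Sum [card_dual_mul] over all points: the [v] blocks carry [v * k] flags in total, and the factor
    [v] cancels. *)
Lemma symmetric_design_params : k * k = k + v.-1 * lambda.
Proof.
case: (symB) => -[cV Bk _] cJ.
have Er : \sum_p #|dual B p| = v * k.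
  have := sum_card_setI B setT setT.
  under eq_bigr do rewrite setTI Bk.
  rewrite sum_nat_const cardsT cJ => ->.
  rewrite [RHS](eq_bigl predT); last by move=> p; rewrite inE.
  by apply: eq_bigr => p _; rewrite setTI.
have : \sum_p (#|dual B p| * k) = \sum_p (#|dual B p| + v.-1 * lambda).
  by apply: eq_bigr => p _; apply: card_dual_mul.
rewrite -big_distrl big_split /= Er sum_nat_const cV -mulnA -mulnDr.
by move/eqP; rewrite eqn_pmul2l ?(ltnW v_gt1) // => /eqP.
Qed.

(** With [r = #|dual B p|], the two previous identities give [r * (k - 1) = k * (k - 1)], and
    [k > 1] because [v.-1 * lambda] is positive. *)
Lemma symmetric_design_replication (p : V) : #|dual B p| = k.
Proof. by have := card_dual_mul p; have := symmetric_design_params; nia. Qed.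

Lemma symmetric_design_meet (j l : J) : j != l -> #|B j :&: B l| = lambda.
Proof.
case: (symB) => -[cV Bk _] cJ jl; pose x i := #|B j :&: B i|.
have xj : x j = k by rewrite /x setIid Bk.
have S1 : \sum_i x i = k * k.
  have := sum_card_setI B (B j) setT.
  rewrite (eq_bigl predT); last by move=> i; rewrite inE.
  move=> ->; rewrite (eq_bigr (fun=> k)) ?sum_nat_const ?Bk // => p _.
  by rewrite setTI symmetric_design_replication.
(* Both sides count triples [(p, q, i)] with [p] and [q], possibly equal, in [B j :&: B i]. *)
have S2 : \sum_i x i ^ 2 = k * (k + k.-1 * lambda).
  transitivity (\sum_(p in B j) \sum_(i in dual B p) x i).
    rewrite (exchange_big_dep predT) //=; apply: eq_bigr => i _.
    rewrite sum_nat_const -mulnn; congr (_ * _).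
    by rewrite /x; apply: eq_card => p; rewrite [RHS]unfold_in !inE.
  rewrite (eq_bigr (fun=> k + k.-1 * lambda)) ?sum_nat_const ?Bk // => p pj.
  by rewrite sum_card_setI sum_dualI // symmetric_design_replication Bk.
rewrite (bigD1 j) //= xj in S1; rewrite (bigD1 j) //= xj in S2.
have N : #|[pred i | i != j]| = v.-1.
  by rewrite -cJ (cardD1 j J); apply: eq_card => i; rewrite !inE andbT.
(* A variance argument without subtraction: [2 * (x i * lambda) <= x i ^ 2 + lambda ^ 2], with
   equality only if [x i = lambda]. The sums over [i != j] agree, so every term is an equality. *)
have /= := leqif_sum (fun i (_ : i != j) => nat_Cauchy (x i) lambda).
case=> _; rewrite -big_distrr -big_distrl big_split /= sum_nat_const N.
have -> : 2 * ((\sum_(i | i != j) x i) * lambda) ==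
          \sum_(i | i != j) x i ^ 2 + v.-1 * lambda ^ 2.
  have ps := symmetric_design_params; apply/eqP; nia.
by move/esym/forall_inP/(_ l); rewrite (eq_sym l) => /(_ jl)/eqP.
Qed.

End SymmetricDesign.

Lemma mem_adjoin_remove (P J : finType) (B : J -> {set P}) (j0 : J) (k : nat)
    (pt : 'I_k -> P) (blk : 'I_k -> J) (j : {j : J | j != j0}) (p : P) :
  reflect (p \in B (val j) \/ exists2 i, blk i = val j & p = pt i)
          (p \in adjoin_remove B j0 pt blk j).
Proof.
rewrite inE; apply: (iffP orP) => -[pj|]; try by left.
  by case/imsetP=> i; rewrite inE => /eqP; right; exists i.
by case=> i ij ->; right; apply/imsetP; exists i; rewrite ?inE ?ij.
Qed.

Unset Implicit Arguments.

Theorem theorem9 (V J : finType) (B : J -> {set V}) (v k lambda : nat)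
    (k_gt0 : 0 < k) (lambda_gt0 : 0 < lambda)
    (symB : is_symmetric_2design B v k lambda)
    (j0 : J) (pt : 'I_k -> V) (blk : 'I_k -> J)
    (block_j0 : B j0 = [set pt i | i : 'I_k])
    (blk_inj : injective blk)
    (blk_neq : forall i : 'I_k, blk i != j0)
    (pt_notin : forall i : 'I_k, pt i \notin B (blk i))
    (pt_asym : forall j l : 'I_k, j != l ->
       pt j \in B (blk l) -> pt l \notin B (blk j)) :
  is_adesign (dual (adjoin_remove B j0 pt blk)) 2 (v - 1) k lambda.
Proof.
case: (symB) => -[cV Bk _] cJ.
pose a0 : 'I_k := Ordinal k_gt0.
have v_gt1 : 1 < v.
  rewrite -cJ; apply: leq_trans (max_card [set blk a0; j0]).
  by rewrite cards2 blk_neq.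
have rep p : #|dual B p| = k.
  exact: symmetric_design_replication symB lambda_gt0 v_gt1 p.
have meet j l : j != l -> #|B j :&: B l| = lambda.
  exact: symmetric_design_meet symB lambda_gt0 v_gt1 j l.
have params := symmetric_design_params symB v_gt1.
have pt_inj : injective pt.
  have /imset_injP inj : #|[set pt i | i : 'I_k]| == #|'I_k|.
    by rewrite -block_j0 Bk card_ord.
  by move=> a b /inj; apply.
have ptB0 a : pt a \in B j0 by rewrite block_j0 imset_f.
set C := adjoin_remove B j0 pt blk.
have cJ0 : #|{: {j : J | j != j0}}| = v - 1.
  rewrite card_sig -cJ (cardD1 j0 J) /= add1n subn1 /=.
  by apply: eq_card => j; rewrite !inE andbT.
pose jb a : {j : J | j != j0} := exist _ (blk a) (blk_neq a).
(* A point [pt a] loses the block [j0] and gains [blk a]; any other point keeps its blocks. *)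
have sz p : #|dual C p| = k.
  rewrite -(card_imset _ val_inj).
  have [|p0] := boolP (p \in B j0).
    rewrite {1}block_j0 => /imsetP[a _ ->].
    suff -> : [set val j | j in dual C (pt a)] = blk a |: (dual B (pt a) :\ j0).
      rewrite cardsU1 !inE (negPf (pt_notin a)) andbF.
      by rewrite -(rep (pt a)) (cardsD1 j0 (dual B (pt a))) inE ptB0.
    apply/setP=> j; rewrite !inE; apply/imsetP/idP.
      case=> -[l l0]; rewrite inE => /mem_adjoin_remove /= H -> /=.
      by case: H => [->|[i <- /pt_inj->]]; rewrite ?l0 ?orbT ?eqxx.
    case/orP=> [/eqP->|/andP[jj0 pj]].
      by exists (jb a) => //; rewrite inE; apply/mem_adjoin_remove; right; exists a.
    by exists (exist _ j jj0) => //; rewrite inE; apply/mem_adjoin_remove; left.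
  rewrite -(rep p); apply: eq_card => j; rewrite inE; apply/imsetP/idP.
    case=> -[l l0]; rewrite inE => /mem_adjoin_remove /= H -> /=.
    by case: H => // -[i _ pE]; rewrite pE ptB0 in p0.
  move=> pj; have jj0 : j != j0 by apply: contraNneq p0 => <-.
  by exists (exist _ j jj0) => //; rewrite inE; apply/mem_adjoin_remove; left.
(* The points by which adjoining enlarges the intersection of two blocks. *)
pose D (j l : {j : J | j != j0}) := (C j :&: C l) :\: (B (val j) :&: B (val l)).
have cardCI j l : j != l -> #|C j :&: C l| = lambda + #|D j l|.
  move=> jl; rewrite -(cardsID (B (val j) :&: B (val l))); congr (_ + _).
  rewrite -(meet (val j) (val l)) //; apply: eq_card => p.
  by rewrite !inE; case: (p \in B _); case: (p \in B _); rewrite ?andbF.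
(* A new common point is adjoined to one block and old in the other: were it adjoined to both,
   injectivity of [pt] would identify the blocks. *)
have memD j l p : j != l -> p \in D j l -> exists a,
    p = pt a /\ (blk a = val j /\ p \in B (val l) \/
                 blk a = val l /\ p \in B (val j)).
  move=> jl /setDP[/setIP[/mem_adjoin_remove Hj /mem_adjoin_remove Hl]].
  rewrite inE; case: Hj Hl => [-> [->//|[a aE ->]] _|].
    by exists a; split=> //; right.
  case=> a aE -> [pl _|]; first by exists a; split=> //; left.
  by case=> b bE /pt_inj ab; rewrite -ab aE in bE; rewrite (val_inj bE) eqxx in jl.
(* Two new points adjoined to the same block contradict [blk_inj]; adjoined to different blocks,
   they contradict [pt_asym]. *)
have D_le1 j l : j != l -> #|D j l| <= 1.
  move=> jl; apply/card_le1_eqP => p q /(memD j l _ jl)[a [-> Ha]].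
  case/(memD j l _ jl) => b [-> Hb]; have [->//|ab] := eqVneq a b.
  case: Ha Hb => -[aE pa] [] [bE pb].
  - by case/eqP: ab; apply: blk_inj; rewrite aE bE.
  - by rewrite -bE in pa; rewrite -aE in pb; case/negP: (pt_asym a b ab pa).
  - by rewrite -bE in pa; rewrite -aE in pb; case/negP: (pt_asym a b ab pa).
  - by case/eqP: ab; apply: blk_inj; rewrite aE bE.
have k_gt1 : 1 < k by nia.
split=> //.
- move=> A /eqP/cards2P[j [l [jl ->]]]; rewrite nblocks_dual2 cardCI //.
  by have := D_le1 j l jl; case: #|D j l| => [|[]] // _; [left|right]; lia.
- have lt_lambda : lambda < k.
    rewrite -(meet _ _ (blk_neq a0)) -(Bk j0) proper_card // properEneq subsetIr.
    rewrite andbT; apply: contraNneq (pt_notin a0) => /setP/(_ (pt a0)).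
    by rewrite inE ptB0 andbT.
  have [l /andP[l0 l_blk]] : exists l, (l != j0) && (l \notin codom blk).
    apply/existsP; apply: contraT; rewrite negb_exists => /forallP cover.
    have le_vk : v <= k.+1.
      rewrite -cJ -(card_ord k) -(card_codom blk_inj) (cardD1 j0 J) add1n ltnS.
      apply: subset_leq_card; apply/subsetP=> l; rewrite !inE andbT => l0.
      by have := cover l; rewrite l0 negbK.
    (* Here [k * (k - 1) = (v - 1) * lambda <= k * lambda], while [lambda < k]. *)
    have E : lambda = k.-1 by nia.
    have B0E a : B j0 :\ pt a = B (blk a) :&: B j0.
      apply/esym/eqP; rewrite eqEcard; apply/andP; split.
        apply/subsetP=> p; rewrite !inE => /andP[pa ->]; rewrite andbT.
        by apply: contraNneq (pt_notin a) => <-.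
      by rewrite meet // E -(Bk j0) [in X in _ <= X.-1](cardsD1 (pt a)) ptB0.
    have all_in a b : a != b -> pt b \in B (blk a).
      move=> ab; have : pt b \in B j0 :\ pt a.
        by rewrite !inE ptB0 (inj_eq pt_inj) eq_sym ab.
      by rewrite B0E => /setIP[].
    have a01 : a0 != Ordinal k_gt1 by [].
    have := pt_asym _ _ a01; rewrite all_in 1?eq_sym // => /(_ isT).
    by rewrite all_in.
  (* The missing point [p = pt a] selects the partner [blk a] of [l]. *)
  have [p pB0 pl] : exists2 p, p \in B j0 & p \notin B l.
    apply/subsetPn; apply: contraL lt_lambda => /setIidPr E.
    by rewrite -leqNgt -(meet _ _ l0) E Bk.
  move: pB0; rewrite block_j0 => /imsetP[a _ pE]; rewrite {p}pE in pl.
  pose l' : {j : J | j != j0} := exist _ l l0.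
  have al : jb a != l'.
    by apply: contraNneq l_blk => /(congr1 val) /= <-; apply: codom_f.
  (* Nothing is adjoined to [l], and the only point adjoined to [blk a] is [pt a], which [B l]
     misses. *)
  have D0 : #|D (jb a) l'| = 0.
    apply/eqP; rewrite cards_eq0 -subset0; apply/subsetP=> p.
    case/(memD _ _ _ al) => b [-> [[/blk_inj-> /(negP pl)//]|[bl _]]].
    by rewrite -(bl : blk b = l) codom_f in l_blk.
  exists [set jb a; l']; rewrite cards2 al nblocks_dual2 cardCI // D0.
  by rewrite addn0.
(* Since [k > 1], some block other than [j0] passes through [pt a0]; it differs from [blk a0], which
   misses that point. *)
- have : 0 < #|dual B (pt a0) :\ j0|.
    by have := rep (pt a0); rewrite (cardsD1 j0) inE ptB0; lia.
  case/card_gt0P=> l; rewrite !inE => /andP[l0 pl].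
  pose l' : {j : J | j != j0} := exist _ l l0.
  have al : jb a0 != l'.
    by apply: contraTneq pl => /(congr1 val) /= <-.
  have D1 : #|D (jb a0) l'| = 1.
    apply/eqP; rewrite eqn_leq D_le1 //=; apply/card_gt0P; exists (pt a0).
    apply/setDP; split; last by rewrite inE (negPf (pt_notin a0)).
    apply/setIP; split; apply/mem_adjoin_remove; last by left.
    by right; exists a0.
  exists [set jb a0; l']; rewrite cards2 al nblocks_dual2 cardCI // D1.
  by split=> //; lia.
Qed.
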